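(* For a semi-Heyting algebra $\mathbf A$, $\mathbf A$ satisfies $0\to1\approx0$ if and only if $\mathbf A$ satisfies $(x^*\to x)^*\approx1$. Thus $\mathbb{AH}=\mathbb{AT}1$.
   Context: A semi-Heyting algebra is an algebra $\langle A;\wedge,\vee,\to,0,1\rangle$ such that $\langle A;\wedge,\vee,0,1\rangle$ is a bounded lattice and the identities $x\wedge(x\to y)\approx x\wedge y$, $x\wedge(y\to z)\approx x\wedge((x\wedge y)\to(x\wedge z))$, $x\to x\approx1$ hold. Write $x^*:=x\to0$. $\mathbb{AH}$ (anti-Heyting algebras) is the variety of semi-Heyting algebras satisfying $0\to1\approx0$; $\mathbb{AT}1$ is the variety of semi-Heyting algebras satisfying $(x^*\to x)^*\approx1$. *)

(* Defs.v *)
From HB Require Import structures.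
From mathcomp Require Import all_boot all_order.
From mathcomp Require Import boolp classical_sets.

Set Implicit Arguments.
Unset Strict Implicit.
Unset Printing Implicit Defensive.

Local Open Scope order_scope.

HB.mixin Record TBLattice_isSemiHeyting d T of Order.TBLattice d T := {
  imp : T -> T -> T;
  meet_imp : forall x y : T, x `&` imp x y = x `&` y;
  meet_impr : forall x y z : T,
    x `&` imp y z = x `&` imp (x `&` y) (x `&` z);
  impxx : forall x : T, imp x x = \top
}.

#[short(type="semiHeytingType")]
HB.structure Definition SemiHeyting d :=
  { T of Order.TBLattice d T & TBLattice_isSemiHeyting d T }.

Notation "x ~> y" := (imp x y) (at level 55, right associativity) : order_scope.

Definition pcompl d (A : semiHeytingType d) (x : A) : A := x ~> \bot.

(* The display d only tags notations; a variety is represented by the class of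
   its algebras. *)
Definition AH d : set (semiHeytingType d) :=
  [set A : semiHeytingType d | (\bot ~> \top) = \bot :> A]%classic.

Definition AT1 d : set (semiHeytingType d) :=
  [set A : semiHeytingType d |
    forall x : A, pcompl (pcompl x ~> x) = \top]%classic.

Arguments AH d : clear implicits.
Arguments AT1 d : clear implicits.

(* Main.v *)
(* Let y = x* ~> x. Always y `&` x* = x* `&` x = \bot, and
   y `&` x = x `&` (\bot ~> x) = x `&` (\bot ~> \top), which is \bot in AH.
   Anything disjoint from x lies below x*, so then y <= x* and y = \bot.
   Conversely, AT1 at x = \top says (\bot ~> \top)* = \top. *)
Require Import Defs.
From mathcomp Require Import all_boot all_order.
From mathcomp Require Import boolp classical_sets.

Import Order.Theory.

Local Open Scope order_scope.

Lemma meet_pcompl d (A : semiHeytingType d) (x : A) : x `&` pcompl x = \bot.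
Proof. by rewrite /pcompl meet_imp meetx0. Qed.

(** Under a meet with [y], [meet_impr] turns [x ~> \bot] into [\bot ~> \bot], which is [\top]. *)
Lemma meet_eq0_le_pcompl d (A : semiHeytingType d) (x y : A) :
  y `&` x = \bot -> y <= pcompl x.
Proof.
by move=> yx0; rewrite leEmeet /pcompl meet_impr yx0 meetx0 impxx meetx1.
Qed.

Lemma pcompl_eq1 d (A : semiHeytingType d) (x : A) :
  pcompl x = \top <-> x = \bot.
Proof.
split=> [xT|->]; last by rewrite /pcompl impxx.
by rewrite -(meet_pcompl _ _ x) xT meetx1.
Qed.

Lemma pcompl_top d (A : semiHeytingType d) : pcompl \top = \bot :> A.
Proof. by rewrite -(meet_pcompl _ _ \top) meet1x. Qed.

(** Relativising [\bot ~> \top] to [x] by [meet_impr] fixes [\bot] and cuts [\top] down to [x]. *)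
Lemma meet_imp_bot d (A : semiHeytingType d) (x : A) :
  x `&` (\bot ~> x) = x `&` (\bot ~> \top).
Proof. by rewrite [RHS]meet_impr meetx0 meetx1. Qed.

Lemma meet_pcompl_imp d (A : semiHeytingType d) (x : A) :
  x `&` (pcompl x ~> x) = x `&` (\bot ~> \top).
Proof. by rewrite meet_impr meet_pcompl meetxx meet_imp_bot. Qed.

Lemma pcompl_imp_eq0 d (A : semiHeytingType d) (x : A) :
  (\bot ~> \top) = \bot :> A -> (pcompl x ~> x) = \bot.
Proof.
move=> h01; have le_yx : (pcompl x ~> x) <= pcompl x.
  by apply: meet_eq0_le_pcompl; rewrite meetC meet_pcompl_imp h01 meetx0.
(* By [le_yx], [pcompl x ~> x] equals its meet with [pcompl x], which [meet_imp] reduces to the meet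
   of [pcompl x] and [x]. *)
by rewrite -(meet_r le_yx) meet_imp meetC meet_pcompl.
Qed.

Lemma AH_iff_AT1 d (A : semiHeytingType d) :
  (\bot ~> \top) = \bot :> A <->
  (forall x : A, pcompl (pcompl x ~> x) = \top).
Proof.
split=> [h01 x|/(_ \top)]; first exact/pcompl_eq1/pcompl_imp_eq0.
by rewrite pcompl_top => /pcompl_eq1.
Qed.

Theorem theorem9p3 (d : Order.disp_t) :
  (forall A : semiHeytingType d,
     (\bot ~> \top) = \bot :> A <->
     (forall x : A, pcompl (pcompl x ~> x) = \top)) /\
  AH d = AT1 d.
Proof.
split; first exact: AH_iff_AT1.
by apply/funext => A; apply/propext; exact: AH_iff_AT1.
Qed.
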